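(* Let $K$ be a finite simplicial complex, $\theta\colon K\to\mathbb{R}^m$ a semi-linear map and $\varepsilon>0$. Then there is a semi-linear map $g\colon K\to\mathbb{R}^m$ such that the Euclidean distance between $g(v)$ and $\theta(v)$ is $<\varepsilon$ for each vertex $v$ of $K$, and such that for any integers $n\ge 0$, $d,t,T$ with $0\le t\le d\le m-n-1$ and $d\le T\le m$, and any $d$-plane $\Pi^d\subset\mathbb{R}^m$ parallel to some coordinate planes $\Pi^t\subset\Pi^T\subset\mathbb{R}^m$, the number $q$ of pairwise disjoint simplexes of $K$ of dimension $\le n$ whose images under $g$ intersect $\Pi^d$ (that is, the cardinality $q$ of any family of pairwise disjoint such simplexes) satisfies: $$q\le d+1-t+\frac{n+(n+T-m)(d-t)}{m-n-d}\quad\text{if } n\ge (m-n-T)(d-t),$$ and $$q\le 1+\frac{n}{m-n-T}\quad\text{if } n\le (m-n-T)(d-t)\text{ and } m-n-T\neq 0.$$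
   Context: A finite simplicial complex $K$ is identified with its underlying polyhedron; simplexes are closed. A map $K\to\mathbb{R}^m$ is semi-linear if it is continuous and its restriction to each simplex of $K$ is affine (linear in barycentric coordinates). A $k$-plane $\Pi^k\subset\mathbb{R}^m$ is a $k$-dimensional affine (not necessarily coordinate) plane. A coordinate $k$-plane is the linear span of $k$ of the standard unit coordinate vectors of $\mathbb{R}^m$. For $t\le d\le T$, a $d$-plane $\Pi^d$ is parallel to coordinate planes $\Pi^t\subset\Pi^T$ if its direction space $V$ (the linear subspace of which $\Pi^d$ is a translate) satisfies $\Pi^t\subset V\subset\Pi^T$. *)

(* Defs.v *)
From mathcomp Require Import all_boot all_order all_algebra.
From mathcomp Require Import all_classical all_reals all_analysis.
Set Implicit Arguments.
Unset Strict Implicit.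
Unset Printing Implicit Defensive.
Import Order.TTheory GRing.Theory Num.Theory.
Import numFieldNormedType.Exports.
Local Open Scope classical_set_scope.
Local Open Scope ring_scope.

Definition barycentric (R : realType) (V : finType) (s : {set V})
    (c : V -> R) : Prop :=
  (forall v, v \in s -> 0 <= c v) /\ \sum_(v in s) c v = 1.

Definition hull (R : realType) (N : nat) (V : finType)
    (pos : V -> 'rV[R]_N) (s : {set V}) : set 'rV[R]_N :=
  [set \sum_(v in s) c v *: pos v | c in [set c | barycentric s c]].

Definition affinely_independent (R : realType) (N : nat) (V : finType)
    (pos : V -> 'rV[R]_N) (s : {set V}) : Prop :=
  forall c : V -> R, \sum_(v in s) c v = 0 ->
    \sum_(v in s) c v *: pos v = 0 -> forall v, v \in s -> c v = 0.

(* A finite geometric simplicial complex in R^N. The finite type V only labels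
   points of R^N; the vertices of the complex are the v with [set v] a face,
   and a simplex is given by its nonempty set of vertices. Since
   hull pos set0 = set0, faces_meet says in particular that simplexes without
   a common vertex are disjoint (and that distinct vertices are distinct
   points). *)
Record simplicial_complex (R : realType) (N : nat) (V : finType) :=
  SimplicialComplex {
    pos : V -> 'rV[R]_N;
    faces : {set {set V}};
    faces_neq0 : finset.set0 \notin faces;
    faces_sub : forall s t : {set V},
      s \in faces -> t \subset s -> t != finset.set0 -> t \in faces;
    faces_indep : forall s, s \in faces -> affinely_independent pos s;
    faces_meet : forall s t, s \in faces -> t \in faces ->
      hull pos s `&` hull pos t `<=` hull pos (s :&: t)
  }.

Section Complex.
Variables (R : realType) (N : nat) (V : finType).
Variable K : simplicial_complex R N V.

Definition is_vertex (v : V) : bool := [set v]%SET \in faces K.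

Definition simplex (s : {set V}) : set 'rV[R]_N := hull (pos K) s.

Definition simplex_dim (s : {set V}) : nat := #|s|.-1.

Definition polyhedron : set 'rV[R]_N := \bigcup_(s in [set` faces K]) simplex s.

(* Only the values of f on the polyhedron matter. *)
Definition semilinear_map (m : nat) (f : 'rV[R]_N -> 'rV[R]_m) : Prop :=
  {within polyhedron, continuous f} /\
  forall s, s \in faces K -> forall c, barycentric s c ->
    f (\sum_(v in s) c v *: pos K v) = \sum_(v in s) c v *: f (pos K v).

End Complex.

Section Planes.
Variables (R : realType) (m : nat).

(* The norm of 'rV[R]_m in the library is the sup norm. *)
Definition euclidean_dist (x y : 'rV[R]_m) : R :=
  Num.sqrt (\sum_(i < m) (x 0 i - y 0 i) ^+ 2).

Definition coordinate_plane (k : nat) (W : {vspace 'rV[R]_m}) : Prop :=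
  exists2 S : {set 'I_m}, #|S| = k &
    W = (\sum_(i in S) <[delta_mx 0%R i]>)%VS.

Definition has_direction (Pi : set 'rV[R]_m) (D : {vspace 'rV[R]_m}) : Prop :=
  exists p : 'rV[R]_m, Pi = [set p + v | v in [set` D]].

Definition affine_plane (d : nat) (Pi : set 'rV[R]_m) : Prop :=
  exists2 D : {vspace 'rV[R]_m}, \dim D = d & has_direction Pi D.

Definition parallel (Pi : set 'rV[R]_m) (Pt PT : {vspace 'rV[R]_m}) : Prop :=
  exists2 D : {vspace 'rV[R]_m}, has_direction Pi D & (Pt <= D <= PT)%VS.

End Planes.

(* Main.v *)
Require Import Defs.
From mathcomp Require Import all_boot all_order all_algebra.
From mathcomp Require Import all_classical all_reals all_analysis.
From mathcomp Require Import zify lra.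
Set Implicit Arguments.
Unset Strict Implicit.
Unset Printing Implicit Defensive.
Import Order.TTheory GRing.Theory Num.Theory.
Import numFieldNormedType.Exports.
Local Open Scope classical_set_scope.
Local Open Scope ring_scope.

(** The map [g] is the semi-linear extension of a choice of vertex images near
those of [theta] and in general position, meaning outside the zero sets of
finitely many nonzero polynomials; the bounds come from a count of parameters.

A [d]-plane whose direction lies between coordinate planes of dimensions [t]
and [T] depends on [(T - d)(d - t) + (m - d)] parameters: the entries of a
matrix whose graph is the direction, and a position ([plane_chart]). If the
image of a [k]-simplex meets the plane at a point [p], then all but one of its
vertex images are free, and the remaining one is a polynomial function of
them, of [k] ratios of barycentric coordinates and of [p], which has [d] degrees
of freedom in the plane. Compared with the [m (k + 1)] coordinates of the
vertices, [m - d - k] parameters are missing. For simplexes without common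
vertices these deficits add up, so when [q] simplexes of dimension at most [n] satisfy
[q (m - n - d) > (T - d)(d - t) + (m - d)], the coordinates of all vertex
images are polynomial functions of fewer parameters than there are
coordinates. They then satisfy a nontrivial polynomial relation
([polyfun_dependent]), which depends only on combinatorial data
([incident_dependent]). There are finitely many such data, so vertex images
arbitrarily close to the given ones avoid all of these relations
([generic_near]), and for them
[q (m - n - d) <= (T - d)(d - t) + (m - d)] ([generic_plane_bound]).

Dividing by [m - n - d] gives the first bound. For the second one, the plane is
enlarged to a translate of the [T]-dimensional coordinate plane; the same
inequality with [d] and [t] both replaced by [T] reads
[q (m - n - T) <= m - T], and the hypotheses of the second case force
[m - n - T > 0]. *)

(** * Polynomial functions *)

Section PolynomialFunctions.
Variable R : realFieldType.
Implicit Types I J : finType.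

(** Polynomial functions of degree at most [h] in each variable separately: they
are spanned by exactly [h.+1 ^ #|I|] monomials, which makes counting easy. *)
Definition polydeg I (h : nat) (f : (I -> R) -> R) : Prop :=
  exists c : {ffun I -> 'I_h.+1} -> R,
    forall y, f y = \sum_e c e * \prod_i y i ^+ e i.

Lemma polydeg_eq I h (f g : (I -> R) -> R) :
  f =1 g -> polydeg h f -> polydeg h g.
Proof. by move=> fg [c fE]; exists c => y; rewrite -fg. Qed.

Lemma polydegD I h (f g : (I -> R) -> R) :
  polydeg h f -> polydeg h g -> polydeg h (fun y => f y + g y).
Proof.
move=> [c fE] [c' gE]; exists (fun e => c e + c' e) => y.
by rewrite fE gE -big_split; apply: eq_bigr => e _; rewrite mulrDl.
Qed.

Lemma polydegZ I h a (f : (I -> R) -> R) :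
  polydeg h f -> polydeg h (fun y => a * f y).
Proof.
move=> [c fE]; exists (fun e => a * c e) => y.
by rewrite fE mulr_sumr; apply: eq_bigr => e _; rewrite mulrA.
Qed.

Lemma polydeg_sum I h (K : Type) (r : seq K) (f : K -> (I -> R) -> R) :
  (forall k, polydeg h (f k)) -> polydeg h (fun y => \sum_(k <- r) f k y).
Proof.
move=> fP; elim: r => [|k r IHr].
  exists (fun=> 0) => y; rewrite big_nil big1 // => e _; exact: mul0r.
apply: polydeg_eq (polydegD (fP k) IHr) => y.
by rewrite big_cons.
Qed.

Lemma polydeg_monomial I h (e : I -> nat) :
  (forall i, e i <= h)%N -> polydeg h (fun y => \prod_i y i ^+ e i).
Proof.
move=> eh; pose e' : {ffun I -> 'I_h.+1} := [ffun i => inord (e i)].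
exists (fun d => (d == e')%:R) => y.
rewrite (bigD1 e') //= eqxx mul1r [X in _ + X]big1 ?addr0; last first.
  by move=> d /negbTE->; rewrite mul0r.
by apply: eq_bigr => i _; rewrite ffunE inordK // ltnS.
Qed.

Lemma polydegW I h h' (f : (I -> R) -> R) :
  (h <= h')%N -> polydeg h f -> polydeg h' f.
Proof.
move=> hh' [c fE]; apply: (@polydeg_eq _ _ _ _ (fsym fE)).
apply: polydeg_sum => e; apply: polydegZ; apply: polydeg_monomial => i.
by apply: leq_trans hh'; rewrite -ltnS.
Qed.

Lemma polydegM I h h' (f g : (I -> R) -> R) :
  polydeg h f -> polydeg h' g -> polydeg (h + h') (fun y => f y * g y).
Proof.
move=> [c fE] [c' gE].
apply: (@polydeg_eq _ _ (fun y => \sum_e \sum_e'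
    (c e * c' e') * \prod_i y i ^+ (e i + e' i))) => [y|].
  rewrite fE gE big_distrl; apply: eq_bigr => e _.
  rewrite big_distrr; apply: eq_bigr => e' _ /=.
  rewrite mulrACA -big_split /=; congr (_ * _).
  by apply: eq_bigr => i _; rewrite exprD.
apply: polydeg_sum => e; apply: polydeg_sum => e'.
apply: polydegZ; apply: polydeg_monomial => i.
by apply: leq_add; rewrite -ltnS.
Qed.

Lemma polydeg_cst I h a : polydeg h (fun _ : I -> R => a).
Proof.
apply: (@polydeg_eq _ _ (fun y : I -> R => a * \prod_i y i ^+ 0)) => [y|].
  by rewrite big1 ?mulr1 // => i _; exact: expr0.
exact/polydegZ/polydeg_monomial.
Qed.

Lemma polydeg_var I (i : I) : polydeg 1 (fun y : I -> R => y i).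
Proof.
apply: (@polydeg_eq _ _ (fun y : I -> R => \prod_j y j ^+ (j == i))) => [y|].
  rewrite (bigD1 i) //= eqxx expr1 big1 ?mulr1 // => j /negbTE->.
  exact: expr0.
by apply: polydeg_monomial => j; exact: leq_b1.
Qed.

Lemma polydeg_prod I h (K : Type) (r : seq K) (f : K -> (I -> R) -> R) :
  (forall k, polydeg h (f k)) ->
  polydeg (h * size r) (fun y => \prod_(k <- r) f k y).
Proof.
move=> fP; elim: r => [|k r IHr].
  apply: polydeg_eq (polydeg_cst I _ 1) => y; by rewrite big_nil.
rewrite mulnS; apply: polydeg_eq (polydegM (fP k) IHr) => y.
by rewrite big_cons.
Qed.

Definition polyfun I (f : (I -> R) -> R) : Prop := exists h, polydeg h f.

Lemma polyfun_eq I (f g : (I -> R) -> R) : f =1 g -> polyfun f -> polyfun g.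
Proof. by move=> fg [h /(polydeg_eq fg) gP]; exists h. Qed.

Lemma polyfun_cst I a : polyfun (fun _ : I -> R => a).
Proof. by exists 0; exact: polydeg_cst. Qed.

Lemma polyfun_var I (i : I) : polyfun (fun y : I -> R => y i).
Proof. by exists 1%N; exact: polydeg_var. Qed.

Lemma polyfunD I (f g : (I -> R) -> R) :
  polyfun f -> polyfun g -> polyfun (fun y => f y + g y).
Proof.
move=> [h fP] [h' gP]; exists (h + h')%N.
by apply: polydegD; [apply: polydegW fP | apply: polydegW gP];
  rewrite ?leq_addr ?leq_addl.
Qed.

Lemma polyfunM I (f g : (I -> R) -> R) :
  polyfun f -> polyfun g -> polyfun (fun y => f y * g y).
Proof. by move=> [h fP] [h' gP]; exists (h + h')%N; exact: polydegM. Qed.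

Lemma polyfun_sum I (K : Type) (r : seq K) (P : pred K)
    (f : K -> (I -> R) -> R) :
  (forall k, polyfun (f k)) -> polyfun (fun y => \sum_(k <- r | P k) f k y).
Proof.
move=> fP; elim: r => [|k r IHr].
  by apply: polyfun_eq (polyfun_cst I 0) => y; rewrite big_nil.
case Pk: (P k).
  by apply: polyfun_eq (polyfunD (fP k) IHr) => y; rewrite big_cons Pk.
by apply: polyfun_eq IHr => y; rewrite big_cons Pk.
Qed.

Lemma polyfun_prod I (K : Type) (r : seq K) (f : K -> (I -> R) -> R) :
  (forall k, polyfun (f k)) -> polyfun (fun y => \prod_(k <- r) f k y).
Proof.
move=> fP; elim: r => [|k r IHr].
  by apply: polyfun_eq (polyfun_cst I 1) => y; rewrite big_nil.
by apply: polyfun_eq (polyfunM (fP k) IHr) => y; rewrite big_cons.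
Qed.

(** Restriction to a line reduces the questions of nonvanishing below to the
finiteness of the set of roots of a univariate polynomial. *)
Lemma polyfun_line I (f : (I -> R) -> R) (x u : I -> R) :
  polyfun f ->
  exists p : {poly R}, forall s, f (fun i => x i + s * u i) = p.[s].
Proof.
move=> [h [c fE]].
exists (\sum_e c e *: \prod_i ((x i)%:P + u i *: 'X) ^+ e i) => s.
rewrite fE horner_sum; apply: eq_bigr => e _.
rewrite hornerZ horner_prod; congr (_ * _); apply: eq_bigr => i _.
by rewrite horner_exp !hornerE [u i * s]mulrC.
Qed.

Lemma poly_nonroot (p : {poly R}) (eta : R) :
  p != 0 -> 0 < eta -> exists s, [/\ 0 < s, s < eta & p.[s] != 0].
Proof.
move=> p0 eta0; pose pts := [seq eta / (i.+2)%:R | i <- iota 0 (size p)].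
have /allPn [s /mapP [i _ ->] sp] : ~~ all (root p) pts.
  apply/negP => pr; have := max_poly_roots p0 pr.
  rewrite size_map size_iota ltnn.
  suff -> : uniq pts by move=> /(_ isT).
  rewrite map_inj_uniq ?iota_uniq // => i j /(mulfI (lt0r_neq0 eta0)).
  by move/invr_inj/eqP; rewrite eqr_nat => /eqP [].
exists (eta / i.+2%:R); split=> //; first by rewrite divr_gt0.
by rewrite ltr_pdivrMr // ltr_pMr // ltr1n.
Qed.

(** On the line through a point where [f] is nonzero and one where [g] is, both
restrict to nonzero univariate polynomials. *)
Lemma polyfun_mul_neq0 I (f g : (I -> R) -> R) x z :
  polyfun f -> polyfun g -> f x != 0 -> g z != 0 ->
  exists y, f y * g y != 0.
Proof.
move=> fP gP fx gz.
have [p pE] := polyfun_line x (fun i => z i - x i) fP.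
have [q qE] := polyfun_line x (fun i => z i - x i) gP.
have p0 : p != 0.
  apply: contra_neq fx => p0; move: (pE 0); rewrite p0 horner0 => <-.
  by congr f; apply/funext => i; rewrite mul0r addr0.
have q0 : q != 0.
  apply: contra_neq gz => q0; move: (qE 1); rewrite q0 horner0 => <-.
  by congr g; apply/funext => i; rewrite mul1r subrKC.
have [s [_ _]] := poly_nonroot (mulf_neq0 p0 q0) ltr01.
by rewrite hornerM -pE -qE; exists (fun i => x i + s * (z i - x i)).
Qed.

Lemma polyfun_prod_neq0 I (K : Type) (r : seq K) (f : K -> (I -> R) -> R) :
  (forall k, polyfun (f k)) -> (forall k, exists z, f k z != 0) ->
  exists y, \prod_(k <- r) f k y != 0.
Proof.
move=> fP f0; elim: r => [|k r [z IHr]].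
  by exists (fun=> 0); rewrite big_nil oner_eq0.
have [x fx] := f0 k.
have [y y0] := polyfun_mul_neq0 (fP k) (polyfun_prod r fP) fx IHr.
by exists y; rewrite big_cons.
Qed.

(** The nonvanishing locus of a nonzero polynomial is dense: on the line from [x]
to [z] only finitely many points are zeros, so some point close to [x] is not. *)
Lemma polyfun_neq0_near I (f : (I -> R) -> R) x z (eta : R) :
  polyfun f -> f z != 0 -> 0 < eta ->
  exists2 y, f y != 0 & forall i, `|y i - x i| < eta.
Proof.
move=> fP fz eta0; pose u i := z i - x i.
have [p pE] := polyfun_line x u fP.
have p0 : p != 0.
  apply: contra_neq fz => p0; move: (pE 1); rewrite p0 horner0 => <-.
  by congr f; apply/funext => i; rewrite mul1r subrKC.
pose U := 1 + \sum_i `|u i|.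
have U0 : 0 < U by rewrite ltr_pwDl // sumr_ge0.
have uU i : `|u i| <= U.
  by rewrite /U (bigD1 i) //= addrCA lerDl addr_ge0 // sumr_ge0.
have [s [s0 sU ps]] := poly_nonroot p0 (divr_gt0 eta0 U0).
exists (fun i => x i + s * u i); first by rewrite pE.
move=> i; rewrite addrAC subrr add0r normrM gtr0_norm //.
apply: le_lt_trans (ler_wpM2l (ltW s0) (uU i)) _.
by rewrite -ltr_pdivlMr.
Qed.

(** With [a] variables and degrees at most [h * D * b], monomials are eventually
fewer than with [b > a] variables and degrees less than [D]: the former number
is of order [D ^ a], the latter is [D ^ b]. *)
Lemma monomial_count (a b h : nat) : (a < b)%N ->
  exists D : nat, ((h * D * b).+1 ^ a < D ^ b)%N.
Proof.
(* As h * D * b < K * D, it suffices that K ^ a < D. *)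
move=> ab; pose K := (h * b).+1; exists (K ^ a).+1.
set D := (K ^ a).+1.
have le1 : ((h * D * b).+1 <= K * D)%N by rewrite /K; nia.
apply: (@leq_ltn_trans ((K * D) ^ a)).
  by case: (a) => // a'; rewrite leq_exp2r.
rewrite expnMn; apply: (@leq_trans (D ^ a.+1)); last by rewrite leq_pexp2l.
by rewrite expnS ltn_pmul2r ?expn_gt0.
Qed.

(** More polynomials than variables are algebraically dependent. The polynomials
in [#|J|] unknowns of degree less than [D] in each form a space of dimension
[D ^ #|J|]; substituting the [f j] maps it into a space which is smaller for
large [D], so this linear map has a nonzero kernel. The basis used is not the
monomials but the products of Lagrange factors on the grid [{0, ..., D-1}^J]: a
nonzero coefficient is then at once a grid point where the polynomial does not
vanish. *)
Lemma polyfun_dependent I J (f : J -> (I -> R) -> R) :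
  (forall j, polyfun (f j)) -> (#|I| < #|J|)%N ->
  exists Q : (J -> R) -> R,
    [/\ polyfun Q, exists z, Q z != 0 & forall y, Q (f ^~ y) = 0].
Proof.
move=> /choice [hs fs] IJ; pose h := \max_j hs j.
have {}fs j : polydeg h (f j) by apply: polydegW (fs j); exact: leq_bigmax.
have [D HD] := monomial_count h IJ.
(* Up to a constant factor, the Lagrange polynomial of the node k. *)
pose L (k : 'I_D) (t : R) : R :=
  \prod_(l <- [seq l <- enum 'I_D | l != k]) (t - l%:R).
have LP k j : polydeg (h * D) (fun y => L k (f j y)).
  apply: (@polydegW _ (h * size [seq l <- enum 'I_D | l != k])).
    rewrite leq_mul2l size_filter (leq_trans (count_size _ _)) ?orbT //.
    by rewrite size_enum_ord.
  apply: (@polydeg_prod _ _ _ _ (fun (l : 'I_D) y => f j y - l%:R)) => l.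
  exact/polydegD/polydeg_cst.
have LE k l : (L k (l : 'I_D)%:R == 0) = (l != k).
  rewrite /L big_filter prodf_seq_eq0; apply/hasP/idP.
    case=> l' _ /andP [l'k]; rewrite subr_eq0 eqr_nat => /eqP/val_inj->.
    exact: l'k.
  by move=> lk; exists l; rewrite ?mem_enum // lk subrr eqxx.
have MP (e : {ffun J -> 'I_D}) :
    polydeg (h * D * #|J|) (fun y => \prod_j L (e j) (f j y)).
  rewrite cardT; apply: polydeg_eq (@polydeg_prod _ _ _ (enum J)
    (fun j y => L (e j) (f j y)) _) => // y.
  by rewrite big_enum.
have [C CE] := choice MP.
pose EJ : finType := {ffun J -> 'I_D}.
pose EI : finType := {ffun I -> 'I_(h * D * #|J|).+1}.
pose A : 'M[R]_(#|EJ|, #|EI|) :=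
  \matrix_(i, j) C (enum_val i) (enum_val j).
have kA : kermx A != 0.
  rewrite kermx_eq0; apply/negP => /eqP rA; have := rank_leq_col A.
  by rewrite rA leqNgt !card_ffun !card_ord HD.
have [i ui0] : exists i, row i (kermx A) != 0.
  apply/existsP; apply: contraR kA => /existsPn k0.
  apply/eqP/row_matrixP => i; rewrite row0; apply/eqP.
  by rewrite -[_ == _]negbK.
set u := row i _ in ui0.
have uA : u *m A = 0 by rewrite -row_mul mulmx_ker row0.
have [k uk] := rV0Pn _ ui0.
exists (fun x => \sum_(e : EJ) u 0 (enum_rank e) * \prod_j L (e j) (x j)).
split.
- apply: polyfun_sum => e; apply: polyfunM; first exact: polyfun_cst.
  apply: (@polyfun_prod _ _ _ (fun j x => L (e j) (x j))) => j.
  apply: (@polyfun_prod _ _ _ (fun (l : 'I_D) x => x j - l%:R)) => l.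
  exact: polyfunD (polyfun_var j) (polyfun_cst _ _).
- pose e0 := enum_val k; exists (fun j => (e0 j)%:R).
  rewrite (bigD1 e0) //= [X in _ + X]big1 ?addr0.
    rewrite enum_valK mulf_neq0 //; apply/prodf_neq0 => j _.
    by rewrite LE eqxx.
  move=> e ee0; have [j ej] : exists j, e0 j != e j.
    apply/existsP; apply: contraR ee0 => /existsPn ee0.
    by apply/eqP/ffunP => j; apply/eqP; rewrite eq_sym -[_ == _]negbK ee0.
  apply/eqP; rewrite mulf_eq0; apply/orP; right.
  by apply/prodf_eq0; exists j => //; rewrite LE.
- move=> y; under eq_bigr => e _ do rewrite CE mulr_sumr.
  rewrite exchange_big big1 //= => e' _.
  under eq_bigr => e _ do rewrite mulrA.
  rewrite -mulr_suml (_ : \sum_e _ = (u *m A) 0 (enum_rank e')).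
    by rewrite uA mxE mul0r.
  rewrite mxE [RHS](reindex enum_rank) /=; last exact/onW_bij/enum_rank_bij.
  by apply: eq_bigr => e _; rewrite [A _ _]mxE !enum_rankK.
Qed.

End PolynomialFunctions.

(** * Simplexes meeting a plane: counting parameters *)

Section Incidence.
Variable R : realFieldType.

Definition extend0 (T : Type) (P : pred T) (e : {x | P x} -> R) (x : T) : R :=
  oapp e 0 (insub x).

Lemma extend0_val (T : Type) (P : pred T) (e : T -> R) x :
  P x -> extend0 (fun z : {x | P x} => e (val z)) x = e x.
Proof. by move=> Px; rewrite /extend0 insubT. Qed.

Lemma polyfun_extend0 (I : finType) (T : Type) (P : pred T)
    (h : {x | P x} -> I) x :
  polyfun (fun y : I -> R => extend0 (fun z => y (h z)) x).
Proof.
rewrite /extend0; case: insubP => [u _ _|_] /=; first exact: polyfun_var.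
exact: polyfun_cst.
Qed.

Variables (V : finType) (m : nat).

Definition vertex_disjoint (F : {set {set V}}) : Prop :=
  forall s s' v, s \in F -> s' \in F -> v \in s -> v \in s' -> s = s'.

(** A point [x] of the parameter space lists the coordinates of all vertex images.
The plane is given by [m - #|S|] affine equations
[p_k = a_k + \sum_j M_kj p_j], [k] outside [S], in which only the indices [j]
outside [St] and [k] inside [ST] interact. For each simplex [s] of the family,
[p s] is a point of the plane, and the image of the vertex [b s] is recovered
from [p s] and the other vertex images; [mu s w] is the ratio of the
barycentric coordinates of [p s] at [w] and [b s], so that
[1 + \sum_w mu s w] is the inverse of the coordinate at [b s]. *)
Definition incident (F : {set {set V}}) (b : {set V} -> V)
    (St S ST : {set 'I_m}) (x : V * 'I_m -> R) : Prop :=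
  exists (a : 'I_m -> R) (M : 'I_m -> 'I_m -> R) (p : {set V} -> 'I_m -> R)
      (mu : {set V} -> V -> R),
    (forall s k, s \in F -> k \notin S -> p s k =
      a k + \sum_(j in S :\: St | k \in ST) M k j * p s j) /\
    (forall s i, s \in F -> x (b s, i) =
      (1 + \sum_(w in s :\ b s) mu s w) * p s i
        - \sum_(w in s :\ b s) mu s w * x (w, i)).

Lemma card_set_sig (T : finType) (A : {set T}) :
  #|{: {x | x \in A}}| = #|A|.
Proof. by rewrite card_sig; exact: eq_card. Qed.

(** Under the numerical hypothesis the incident [x] are values of a polynomial map
with fewer parameters than coordinates. The parameters are the images of the
vertices outside [B = b @: F], the [a_k], the [M_kj], the ratios [mu s w], and
the coordinates of the [p s] indexed by [S]; as the simplexes are disjoint, [b]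
is injective on [F], and the vertices other than [b s] of a simplex [s] of the
family lie outside [B]. *)
Lemma incident_dependent (F : {set {set V}}) (b : {set V} -> V)
    (St S ST : {set 'I_m}) :
  (forall s, s \in F -> b s \in s) ->
  vertex_disjoint F ->
  (#|~: S| + #|ST :\: S| * #|S :\: St| + \sum_(s in F) #|s :\ b s|
     + #|F| * #|S| < #|F| * m)%N ->
  exists Q : (V * 'I_m -> R) -> R,
    [/\ polyfun Q, exists z, Q z != 0 &
        forall x, incident F b St S ST x -> Q x = 0].
Proof.
move=> bs Fdisj count.
have b_inj : {in F &, injective b}.
  by move=> s s' sF s'F bss'; apply: (Fdisj _ _ (b s)); rewrite ?bs // bss' bs.
pose B := b @: F.
pose Ix : finType := ({v | v \notin B} * 'I_m)%type.
pose Ia : finType := {k | k \in ~: S}.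
pose IM : finType := ({k | k \in ST :\: S} * {j | j \in S :\: St})%type.
pose Imu : finType :=
  {sw : {set V} * V | (sw.1 \in F) && (sw.2 \in sw.1 :\ b sw.1)}.
pose Ip : finType := ({s | s \in F} * {i | i \in S})%type.
pose I : finType := (Ix + Ia + IM + Imu + Ip)%type.
pose X (y : I -> R) v i :=
  extend0 (fun z : {v | v \notin B} => y (inl (inl (inl (inl (z, i)))))) v.
pose a (y : I -> R) k :=
  extend0 (fun z : Ia => y (inl (inl (inl (inr z))))) k.
pose M (y : I -> R) k j := extend0 (fun z : {k | k \in ST :\: S} =>
  extend0 (fun z' : {j | j \in S :\: St} => y (inl (inl (inr (z, z'))))) j) k.
pose mu (y : I -> R) s w :=
  extend0 (fun z : Imu => y (inl (inr z))) (s, w).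
pose p0 (y : I -> R) s i := extend0 (fun z : {s | s \in F} =>
  extend0 (fun z' : {i | i \in S} => y (inr (z, z'))) i) s.
pose p (y : I -> R) s k := if k \in S then p0 y s k else
  a y k + \sum_(j in S :\: St | k \in ST) M y k j * p0 y s j.
pose f (vi : V * 'I_m) (y : I -> R) := if vi.1 \notin B then X y vi.1 vi.2 else
  \sum_(s in F | b s == vi.1) ((1 + \sum_(w in s :\ b s) mu y s w) * p y s vi.2
    + (-1) * \sum_(w in s :\ b s) mu y s w * X y w vi.2).
have XP v i : polyfun (fun y => X y v i) by exact: polyfun_extend0.
have aP k : polyfun (fun y => a y k) by exact: polyfun_extend0.
have MP k j : polyfun (fun y => M y k j).
  rewrite /M /extend0; case: insubP => [u _ _|_] /=; last exact: polyfun_cst.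
  exact: polyfun_extend0.
have muP s w : polyfun (fun y => mu y s w) by exact: polyfun_extend0.
have p0P s i : polyfun (fun y => p0 y s i).
  rewrite /p0 /extend0; case: insubP => [u _ _|_] /=; last exact: polyfun_cst.
  exact: polyfun_extend0.
have pP s k : polyfun (fun y => p y s k).
  rewrite /p; case: (k \in S) => //; apply: polyfunD => //.
  by apply: polyfun_sum => j; exact: polyfunM.
have fP vi : polyfun (f vi).
  rewrite /f; case: (vi.1 \notin B) => //; apply: polyfun_sum => s.
  apply: polyfunD.
    apply: polyfunM => //; apply: polyfunD; first exact: polyfun_cst.
    exact: polyfun_sum.
  apply: polyfunM; first exact: polyfun_cst.
  by apply: polyfun_sum => w; exact: polyfunM.
have cardI : (#|I| < #|{: V * 'I_m}|)%N.
  have Imu_card : #|{: Imu}| = (\sum_(s in F) #|s :\ b s|)%N.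
    rewrite card_sig -sum1_card.
    under [RHS]eq_bigr => s _ do rewrite -sum1_card.
    by rewrite pair_big_dep.
  have B_card : #|B| = #|F| by rewrite card_in_imset.
  have NB_card : #|[pred v | v \notin B]| = (#|V| - #|F|)%N.
    by rewrite -B_card -(cardC B) addKn; exact: eq_card.
  have F_le : (#|F| <= #|V|)%N by rewrite -B_card max_card.
  rewrite !card_sum !card_prod Imu_card !card_set_sig card_sig NB_card card_ord.
  rewrite mulnBl.
  have : (#|F| * m <= #|V| * m)%N by rewrite leq_mul2r F_le orbT.
  move: count; lia.
have [Q [QP Q0 Qf]] := polyfun_dependent fP cardI.
exists Q; split=> // x [a' [M' [p' [mu' [pE xE]]]]].
pose y (z : I) : R := match z with
  | inl (inl (inl (inl z))) => x (val z.1, z.2)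
  | inl (inl (inl (inr z))) => a' (val z)
  | inl (inl (inr z)) => M' (val z.1) (val z.2)
  | inl (inr z) => mu' (val z).1 (val z).2
  | inr z => p' (val z.1) (val z.2)
  end.
rewrite -(Qf y); congr Q; apply/funext => -[v i].
have yX w : w \notin B -> X y w i = x (w, i).
  by move=> wB; exact: (extend0_val (fun w => x (w, i))).
have yp0 s j : s \in F -> j \in S -> p0 y s j = p' s j.
  move=> sF jS; rewrite /p0 {1}/extend0 (insubT (fun s => s \in F) sF) /=.
  exact: (extend0_val (fun j => p' s j)).
have yp s : s \in F -> p y s i = p' s i.
  move=> sF; rewrite /p; case: ifPn => iS; first exact: yp0.
  rewrite pE // /a (@extend0_val _ _ a' i) ?inE //; congr (_ + _).
  apply: eq_bigr => j /andP [jS iST]; rewrite yp0 //; last first.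
    by move: jS; rewrite inE => /andP [].
  congr (_ * _); have iP : i \in ST :\: S by rewrite inE iS.
  rewrite /M {1}/extend0 (insubT (fun k => k \in ST :\: S) iP) /=.
  by rewrite (extend0_val (fun j => M' i j)).
have ymu s w : s \in F -> w \in s :\ b s -> mu y s w = mu' s w.
  move=> sF ws; apply: (@extend0_val _ _ (fun sw => mu' sw.1 sw.2) (s, w)).
  by rewrite /= sF ws.
rewrite /f /=; case: ifPn => [vB|]; first by rewrite yX.
rewrite negbK => /imsetP [s sF vE].
(* As b is injective on F, only s contributes to the image of its vertex b s. *)
rewrite (bigD1 s) ?sF ?vE ?eqxx //= [X in _ + X]big1 ?addr0; last first.
  by move=> s' /andP [/andP [s'F /eqP/b_inj->]]; rewrite ?eqxx.
rewrite xE // yp // mulN1r; congr (_ * _ - _).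
  by congr (1 + _); apply: eq_bigr => w ws; rewrite ymu.
apply: eq_bigr => w ws; rewrite ymu // yX //.
apply/imsetP => -[s' s'F wE]; move: ws; rewrite !inE wE => /andP [bb' b's].
by rewrite (Fdisj _ _ _ sF s'F b's (bs _ s'F)) eqxx in bb'.
Qed.

End Incidence.

(** * Planes between coordinate planes *)

Section CoordinatePlanes.
Variables (R : realFieldType) (m : nat).
Implicit Types (D : {vspace 'rV[R]_m}) (A S : {set 'I_m}).

Definition coordspan A : {vspace 'rV[R]_m} :=
  (\sum_(i in A) <[delta_mx 0%R i]>)%VS.

Lemma delta_coordspan A i : i \in A -> delta_mx 0 i \in coordspan A.
Proof.
by move=> iA; apply: (subvP (sumv_sup i iA (subvv _))); exact: memv_line.
Qed.

Lemma coordspanP A (v : 'rV[R]_m) :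
  reflect (forall k, k \notin A -> v 0 k = 0) (v \in coordspan A).
Proof.
apply: (iffP idP) => [/memv_sumP [f fA ->] k kA|v0].
  rewrite summxE big1 // => i iA.
  have /vlineP [a ->] := fA i iA.
  by rewrite !mxE eqxx /=; case: eqP kA => [->|]; rewrite ?iA ?mulr0.
rewrite [v]row_sum_delta; apply: memv_suml => k _.
have [kA|/v0 ->] := boolP (k \in A); last by rewrite scale0r mem0v.
exact/memvZ/delta_coordspan.
Qed.

Lemma dim_coordspan_le A : (\dim (coordspan A) <= #|A|)%N.
Proof.
rewrite (leq_trans (dimv_leq_sum _ _ _)) //; rewrite -sum1_card.
by apply: leq_sum => i _; rewrite dim_vline leq_b1.
Qed.

Lemma dim_coordspan A : \dim (coordspan A) = #|A|.
Proof.
apply/eqP; rewrite eqn_leq dim_coordspan_le /=.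
have full : (fullv <= coordspan A + coordspan (~: A))%VS.
  apply/subvP => v _; rewrite [v]row_sum_delta; apply: memv_suml => k _.
  apply: memvZ; have [kA|kA] := boolP (k \in A).
    by apply: (subvP (addvSl _ _)); exact: delta_coordspan.
  by apply: (subvP (addvSr _ _)); apply: delta_coordspan; rewrite inE.
have := leq_trans (dimvS full) (dimv_add_leqif _ _).1.
rewrite dimvf /dim /= mul1n => le1.
have := leq_trans le1 (leq_add (leqnn _) (dim_coordspan_le _)).
by rewrite -{1}[m]card_ord -(cardsC A) leq_add2r.
Qed.

(** Steinitz exchange: a maximal coordinate plane [coordspan A] meeting [D]
trivially is a complement of [D]. Hence [D] is a graph over the coordinates in
the complement [S] of [A], and [M k j] is the [k]-th coordinate of the
projection [w j] of the [j]-th unit vector to [D] along [coordspan A]. For [j]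
in [St] this unit vector lies in [D] already, and for [k] outside [ST] all
[k]-th coordinates vanish on [D]: this is why the sum is restricted. *)
Lemma plane_chart D (St ST : {set 'I_m}) :
  (coordspan St <= D)%VS -> (D <= coordspan ST)%VS ->
  exists (S : {set 'I_m}) (M : 'I_m -> 'I_m -> R),
    [/\ St \subset S, S \subset ST, #|S| = \dim D &
        forall (v : 'rV[R]_m) k, v \in D -> k \notin S ->
          v 0 k = \sum_(j in S :\: St | k \in ST) M k j * v 0 j].
Proof.
move=> StD DST.
pose P A := (D :&: coordspan A == 0)%VS.
have PT : P (~: ST).
  rewrite /P -subv0; apply/subvP => v; rewrite memv_cap => /andP [vD vT].
  rewrite memv0; apply/eqP/rowP => k; rewrite mxE.
  have [kT|kT] := boolP (k \in ST).
    by move/coordspanP: vT; apply; rewrite inE kT.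
  by move/(subvP DST)/coordspanP: vD; apply.
have [A /maxsetP [/eqP DA0 Amax] TA] := maxset_exists PT.
have DA v : v \in D -> v \in coordspan A -> v = 0.
  by move=> vD vA; apply/eqP; rewrite -memv0 -DA0 memv_cap vD.
have gen k : delta_mx 0 k \in (D + coordspan A)%VS.
  apply: contraT => kDA.
  have kA : k \notin A.
    apply: contra kDA => kA; apply: (subvP (addvSr _ _)).
    exact: delta_coordspan.
  suff /Amax/(_ (finset.subsetUr _ _)) kAE : P (k |: A).
    by rewrite -kAE setU11 in kA.
  rewrite /P -subv0; apply/subvP => v; rewrite memv_cap => /andP [vD vkA].
  have vA : v - v 0 k *: delta_mx 0 k \in coordspan A.
    apply/coordspanP => i iA; rewrite !mxE /=.
    case: (eqVneq i k) => [->|ik]; first by rewrite mulr1 subrr.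
    rewrite mulr0 subr0; move/coordspanP: vkA; apply.
    by rewrite !inE negb_or ik.
  have vk0 : v 0 k = 0.
    apply: contraNeq kDA => vk0.
    have -> : delta_mx 0 k = (v 0 k)^-1 *: v
        - (v 0 k)^-1 *: (v - v 0 k *: delta_mx 0 k).
      by rewrite -scalerBr subKr scalerA mulVf // scale1r.
    rewrite memvB // memvZ //; first by apply: (subvP (addvSl _ _)).
    by apply: (subvP (addvSr _ _)).
  by rewrite vk0 scale0r subr0 in vA; rewrite memv0 (DA v).
have full : (D + coordspan A)%VS = fullv.
  apply/eqP; rewrite eqEsubv subvf /=; apply/subvP => v _.
  by rewrite [v]row_sum_delta; apply: memv_suml => k _; exact: memvZ.
have dimA : \dim D = #|~: A|.
  have := dimv_disjoint_sum DA0.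
  rewrite full dim_coordspan dimvf /dim /= mul1n => mE.
  by apply/eqP; rewrite -(eqn_add2r #|A|) -mE addnC cardsC card_ord.
have /choice [w wP] (j : 'I_m) : exists w : 'rV[R]_m,
    w \in D /\ delta_mx 0 j - w \in coordspan A.
  have /memv_addP [w wD [r rA ->]] := gen j.
  by exists w; split=> //; rewrite addrC addKr.
exists (~: A), (fun k j => w j 0 k); split.
- apply/fintype.subsetP => k kt; rewrite inE; apply/negP => kA.
  have kD := subvP StD _ (delta_coordspan kt).
  have /rowP /(_ k) := DA _ kD (delta_coordspan kA).
  by rewrite !mxE !eqxx => /eqP; rewrite oner_eq0.
- by rewrite -(finset.setCK ST) finset.setCS.
- by rewrite dimA.
move=> v k vD; rewrite inE negbK => kA.
have /DA vE : v - \sum_(j in ~: A) v 0 j *: w j \in D.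
  by rewrite memvB // memv_suml // => j _; rewrite memvZ // (wP j).1.
have /vE/rowP/(_ k) : v - \sum_(j in ~: A) v 0 j *: w j \in coordspan A.
  apply/coordspanP => i iA; rewrite !mxE summxE (bigD1 i) ?inE //= big1 ?addr0.
    have := (wP i).2 => /coordspanP/(_ i iA); rewrite !mxE !eqxx.
    by move=> /subr0_eq <-; rewrite mulr1 subrr.
  move=> j /andP [_ ji]; rewrite !mxE; have := (wP j).2 => /coordspanP/(_ i iA).
  rewrite !mxE eqxx /= eq_sym (negbTE ji) => /subr0_eq <-; exact: mulr0.
rewrite !mxE summxE => /subr0_eq ->.
rewrite [LHS]big_mkcond [RHS]big_mkcond; apply: eq_bigr => j _ /=.
rewrite !inE mxE; case: (boolP (j \in A)) => jA /=; first by rewrite andbF.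
have [jt|jt] /= := boolP (j \in St).
  suff /subr0_eq <- : delta_mx 0 j - w j = 0.
    by rewrite !mxE eqxx; case: eqP jA => [<-|]; rewrite ?kA ?mulr0.
  apply: (DA _ _ (wP j).2); rewrite memvB ?(wP j).1 //.
  exact/(subvP StD)/delta_coordspan.
case: ifPn => [_|kT]; first exact: mulrC.
by have /(subvP DST)/coordspanP -> := (wP j).1; rewrite ?mulr0.
Qed.

End CoordinatePlanes.

(** * Vertices in general position *)

Section GenericVertices.
Variables (R : realType) (V : finType) (m : nat).

Definition generic (x : V * 'I_m -> R) : Prop :=
  forall (F : {set {set V}}) (b : {ffun {set V} -> V}) (St S ST : {set 'I_m}),
    (forall s, s \in F -> b s \in s) -> vertex_disjoint F ->
    incident F b St S ST x ->
    (#|F| * m <= #|~: S| + #|ST :\: S| * #|S :\: St|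
                 + \sum_(s in F) #|s :\ b s| + #|F| * #|S|)%N.

(** Only finitely many choices of [F], [b], [St], [S] and [ST] exist, each
excluding at most the zeros of one nonzero polynomial, and the product of these
polynomials is again nonzero. *)
Lemma generic_near (x0 : V * 'I_m -> R) (eta : R) : 0 < eta ->
  exists2 x, generic x & forall vi, `|x vi - x0 vi| < eta.
Proof.
move=> eta0.
pose C : finType := ({set {set V}} * {ffun {set V} -> V} * {set 'I_m} *
  {set 'I_m} * {set 'I_m})%type.
pose bad (k : C) (x : V * 'I_m -> R) := let: (F, b, At, A, AT) := k in
  [/\ forall s, s \in F -> b s \in s, vertex_disjoint F,
      incident F b At A AT x &
      (#|~: A| + #|AT :\: A| * #|A :\: At|
       + \sum_(s in F) #|s :\ b s| + #|F| * #|A| < #|F| * m)%N].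
have /choice [Q QP] (k : C) : exists Q : (V * 'I_m -> R) -> R,
    [/\ polyfun Q, exists z, Q z != 0 & forall x, bad k x -> Q x = 0].
  move: k => [[[[F b] St] S] ST].
  have [[x1 [bs Fd _ lt]]|nobad] := pselect (exists x, bad (F, b, St, S, ST) x).
    have [Q [QP Q0 QE]] := incident_dependent R bs Fd lt.
    by exists Q; split=> // x [_ _ /QE].
  exists (fun=> 1); split; first exact: polyfun_cst.
    by exists (fun=> 0); exact: oner_neq0.
  by move=> x xbad; case: nobad; exists x.
have Qpoly k : polyfun (Q k) by case: (QP k).
have Qneq0 k : exists z, Q k z != 0 by case: (QP k).
have [z z0] := polyfun_prod_neq0 (enum C) Qpoly Qneq0.
have [x xQ xx0] := polyfun_neq0_near x0 (polyfun_prod (enum C) Qpoly) z0 eta0.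
exists x => // F b St S ST bs Fd xinc; rewrite leqNgt; apply/negP => lt.
have [_ _ /(_ x) Qx] := QP (F, b, St, S, ST).
move: xQ; rewrite prodf_seq_neq0 => /allP /(_ (F, b, St, S, ST)).
by rewrite mem_enum => /(_ isT) /=; rewrite Qx ?eqxx.
Qed.

(** This is [q (m - n - d) <= (T - d)(d - t) + (m - d)] for the plane through
[base] with direction [D], with the negative terms of the left-hand side moved
to the right because subtraction of natural numbers is truncated. The
coefficients [c] sum to [1], so one of them is nonzero, and its vertex can be
taken as [b s]. *)
Lemma generic_plane_bound (x : V * 'I_m -> R) (St ST : {set 'I_m})
    (D : {vspace 'rV[R]_m}) (base : 'rV[R]_m) (F : {set {set V}}) (n : nat) :
  generic x -> (coordspan R St <= D)%VS -> (D <= coordspan R ST)%VS ->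
  vertex_disjoint F -> (forall s, s \in F -> #|s| <= n.+1)%N ->
  (forall s, s \in F -> exists2 c : V -> R, \sum_(v in s) c v = 1 &
     \sum_(v in s) c v *: \row_i x (v, i) - base \in D) ->
  (#|F| * m <= m - \dim D + (#|ST| - \dim D) * (\dim D - #|St|)
               + #|F| * n + #|F| * \dim D)%N.
Proof.
move=> xgen StD DST Fd Fn Fx.
have [->|/set0Pn [s0 s0F]] := eqVneq F finset.set0.
  by rewrite cards0 mul0n.
have [S [M [StS SST <- chart]]] := plane_chart StD DST.
have /choice [c cP] (s : {set V}) : exists c : V -> R, s \in F ->
    \sum_(v in s) c v = 1 /\ \sum_(v in s) c v *: \row_i x (v, i) - base \in D.
  have [/Fx [c c1 cD]|_] := boolP (s \in F); last by exists (fun=> 0).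
  by exists c.
have c_neq0 s : s \in F -> exists2 v, v \in s & c s v != 0.
  move=> /cP [c1 _]; apply/exists_inP; apply: contra_eqT c1 => /exists_inPn c0.
  rewrite big1 1?eq_sym ?oner_neq0 // => v vs; apply/eqP.
  by have := c0 v vs; rewrite negbK.
have /choice [b bP] (s : {set V}) :
    exists v, s \in F -> v \in s /\ c s v != 0.
  have [/c_neq0 [v vs cv]|_] := boolP (s \in F); first by exists v.
  by have [v _ _] := c_neq0 s0 s0F; exists v.
pose p (s : {set V}) : 'rV[R]_m := \sum_(v in s) c s v *: \row_i x (v, i).
have := xgen F [ffun s => b s] St S ST.
have -> : \sum_(s in F) #|s :\ [ffun s => b s] s| = (\sum_(s in F) #|s|.-1)%N.
  apply: eq_bigr => s sF; rewrite ffunE.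
  by rewrite [in RHS](cardsD1 (b s)) (bP s sF).1.
have cardS : #|~: S| = (m - #|S|)%N by rewrite cardsCs finset.setCK card_ord.
have cardSTS : #|ST :\: S| = (#|ST| - #|S|)%N.
  by rewrite cardsD (finset.setIidPr SST).
have cardSSt : #|S :\: St| = (#|S| - #|St|)%N.
  by rewrite cardsD (finset.setIidPr StS).
rewrite cardS cardSTS cardSSt => bound; apply: leq_trans (bound _ Fd _) _.
- by move=> s sF; rewrite ffunE (bP s sF).1.
- pose q (s : {set V}) k := p s 0 k.
  exists (fun k => base 0 k
    - \sum_(j in S :\: St | k \in ST) M k j * base 0 j), M, q.
  (* Dividing the barycentric combination by its coefficient at b s solves it
     for the image of b s. *)
  exists (fun s w => c s w / c s (b s)); split=> [s k sF kS|s i sF].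
    have := chart _ k (cP s sF).2 kS; rewrite -/(p s) !mxE.
    move=> /(canRL (subrK _)); rewrite /q => ->.
    rewrite addrC -addrA; congr (_ + _).
    rewrite addrC -sumrB; apply: eq_bigr => j _.
    by rewrite [X in _ * X]mxE [X in _ + X]mxE mulrBr.
  rewrite !ffunE; have [bs cb0] := bP s sF; have [c1 _] := cP s sF.
  rewrite /q /p summxE; rewrite (big_setD1 (b s)) //= in c1.
  have -> : 1 + \sum_(w in s :\ b s) c s w / c s (b s) = (c s (b s))^-1.
    by rewrite -mulr_suml -[1](divff cb0) -mulrDl c1 mul1r.
  rewrite (big_setD1 (b s)) //= !mxE mulrDr mulKf //.
  rewrite mulr_sumr -addrA -sumrB big1 ?addr0 // => w _.
  by rewrite !mxE mulrCA mulrA subrr.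
- rewrite leq_add2r leq_add2l -sum_nat_const; apply: leq_sum => s sF.
  by have := Fn s sF; case: #|s|.
Qed.

End GenericVertices.

(** * Semi-linear extension of vertex maps *)

Section BarycentricExtension.
Variables (R : realType) (N : nat) (V : finType).

Lemma continuous_sum_fun (T : topologicalType) (W : normedModType R)
    (I : Type) (r : seq I) (f : I -> T -> W) :
  (forall i, continuous (f i)) -> continuous (fun y => \sum_(i <- r) f i y).
Proof.
move=> fc; elim: r => [|i r IHr].
  by under eq_fun do rewrite big_nil; move=> y; exact: cst_continuous.
under eq_fun do rewrite big_cons.
by move=> y; apply: cvgD; [exact: fc|exact: IHr].
Qed.

(** The rows of [A] indexed by [s] are the points [(q v, 1)], the other ones are
zero. Affine independence says that a row vector [u] is determined on [s] by
[u *m A], so the partial inverse [pinvmx A] computes barycentric coordinates on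
the affine span of the simplex, and it does so by affine, hence continuous,
functions. *)
Lemma barycentric_coordinates (q : V -> 'rV[R]_N) (s : {set V}) :
  affinely_independent q s ->
  exists beta : V -> 'rV[R]_N -> R,
    (forall v, continuous (beta v)) /\
    (forall c : V -> R, \sum_(v in s) c v = 1 ->
      forall v, beta v (\sum_(v in s) c v *: q v) =
        if v \in s then c v else 0).
Proof.
move=> q_ind.
pose A : 'M[R]_(#|V|, N + 1) := \matrix_(i < #|V|)
  (if enum_val i \in s then row_mx (q (enum_val i)) 1%:M else 0).
have EA (c : V -> R) : (\row_i c (enum_val i)) *m A =
    row_mx (\sum_(v in s) c v *: q v) (\sum_(v in s) c v)%:M.
  have -> : (\row_i c (enum_val i)) *m A =
      \sum_(v in s) c v *: row_mx (q v) 1%:M.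
    rewrite mulmx_sum_row [RHS]big_mkcond.
    rewrite [RHS](reindex (@enum_val V V)) /=; last first.
      exact/onW_bij/enum_val_bij.
    apply: eq_bigr => i _; rewrite mxE rowK.
    by case: ifP => _ //; rewrite scaler0.
  apply/rowP => j; rewrite -(fintype.splitK j) summxE.
  case: (fintype.split j) => k /=.
    rewrite row_mxEl summxE; apply: eq_bigr => v _.
    by rewrite mxE row_mxEl [RHS]mxE.
  rewrite row_mxEr (ord1 k) [RHS]mxE eqxx mulr1n; apply: eq_bigr => v _.
  by rewrite mxE row_mxEr mxE eqxx mulr1.
pose u (y : 'rV[R]_N) := row_mx y 1%:M *m pinvmx A.
exists (fun v y => if v \in s then u y 0 (enum_rank v) else 0); split.
  have rc j :
      continuous (fun y : 'rV[R]_N => (row_mx y 1%:M : 'rV_(N + 1)) 0 j).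
    move=> y; rewrite -(fintype.splitK j); case: (fintype.split j) => k /=.
      under eq_fun do rewrite row_mxEl; exact: coord_continuous.
    under eq_fun do rewrite row_mxEr; exact: cst_continuous.
  move=> v; case: (v \in s); last exact: cst_continuous.
  rewrite /u; under eq_fun do rewrite mxE.
  apply: continuous_sum_fun => j y.
  by apply: continuousM; [exact: rc|exact: cst_continuous].
move=> c c1 v; case: ifP => vs //; set y := \sum_(v in s) _.
pose c' w := u y 0 (enum_rank w).
have uc : u y = \row_i c' (enum_val i).
  by apply/rowP => i; rewrite [RHS]mxE /c' enum_valK.
have uA : u y *m A = row_mx y 1%:M.
  apply: mulmxKpV; apply/submxP; exists (\row_i c (enum_val i)).
  by rewrite EA c1.
have [cy c'1] : \sum_(v in s) c' v *: q v = y /\ \sum_(v in s) c' v = 1.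
  have := uA; rewrite uc EA => /eq_row_mx [-> /matrixP/(_ 0 0)].
  by rewrite !mxE eqxx !mulr1n => ->.
apply/eqP; rewrite -subr_eq0; apply/eqP.
apply: (q_ind (fun w => c' w - c w)) => //.
  by rewrite big_split /= sumrN c1 c'1 subrr.
rewrite (eq_bigr (fun w => c' w *: q w - c w *: q w)) => [|w _].
  by rewrite big_split /= sumrN cy subrr.
exact: scalerBl.
Qed.

Lemma continuous_combination (W : normedModType R) (s : {set V})
    (beta : V -> 'rV[R]_N -> R) (x : V -> W) :
  (forall v, continuous (beta v)) ->
  continuous (fun y => \sum_(v in s) beta v y *: x v).
Proof.
move=> bc; under eq_fun do rewrite big_mkcond /=.
apply: continuous_sum_fun => v; case: (v \in s); last exact: cst_continuous.
by move=> y; apply: continuousZr_tmp; exact: bc.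
Qed.

(** The extended barycentric coordinates describe the simplex by weak inequalities
and equalities between continuous functions. *)
Lemma hull_closed (q : V -> 'rV[R]_N) (s : {set V}) :
  affinely_independent q s -> closed (hull q s).
Proof.
move=> /barycentric_coordinates [beta [bc bE]].
pose f0 y := \sum_(v in s) beta v y *: q v - y.
pose f1 y : R^o := \sum_(v in s) beta v y *: (1 : R^o).
have -> : hull q s = f0 @^-1` [set 0] `&` (f1 @^-1` [set 1] `&`
   \bigcap_(v in [set` s]) (beta v @^-1` [set x | 0 <= x])).
  apply/seteqP; split=> [y /= [c [c0 c1] <-]|y [/= /subr0_eq yE [b1 b0]]].
    have bs v : v \in s -> beta v (\sum_(v in s) c v *: q v) = c v.
      by move=> vs; rewrite bE // vs.
    split=> /=.
      rewrite /f0 (eq_bigr (fun v => c v *: q v)) ?subrr // => v vs.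
      by rewrite bs.
    split; last by move=> v /= vs; rewrite bs ?c0.
    rewrite /f1 -[RHS]c1; apply: eq_bigr => v vs.
    by rewrite bs // [LHS]mulr1.
  exists (beta^~ y) => //; split; first by move=> v vs; exact: b0.
  by rewrite -[RHS]b1; apply: eq_bigr => v vs; rewrite [RHS]mulr1.
have closed_pre (W : topologicalType) (f : 'rV[R]_N -> W) (D : set W) :
    continuous f -> closed D -> closed (f @^-1` D).
  by move=> /continuous_closedP; apply.
apply: closedI; last apply: closedI.
- apply: closed_pre.
    move=> y; apply: continuousB; last exact: cvg_id.
    exact: continuous_combination.
  exact/accessible_closed_set1/hausdorff_accessible/norm_hausdorff.
- apply: closed_pre; first exact: continuous_combination.
  exact/accessible_closed_set1/hausdorff_accessible/norm_hausdorff.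
- by apply: closed_bigI => v _; apply: closed_pre; [exact: bc|exact: closed_ge].
Qed.

Variable K : simplicial_complex R N V.

Lemma face_vertex s v : s \in faces K -> v \in s -> is_vertex K v.
Proof.
move=> sK vs; apply: (faces_sub sK); first by rewrite finset.sub1set.
by apply/set0Pn; exists v; rewrite inE.
Qed.

(** Pasting along a finite cover by closed sets. *)
Lemma within_polyhedron_continuous (W : topologicalType) (g : 'rV[R]_N -> W) :
  (forall s, s \in faces K -> {within simplex K s, continuous g}) ->
  {within polyhedron K, continuous g}.
Proof.
move=> gc; have -> : polyhedron K =
    \big[setU/classical_sets.set0]_(s <- enum (faces K)) simplex K s.
  rewrite -bigcup_seq /polyhedron; congr bigcup.
  by apply/seteqP; split=> s /=; rewrite mem_enum.
have : all [in faces K] (enum (faces K)).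
  by apply/allP => s; rewrite mem_enum.
elim: (enum _) => [_|s r IHr /= /andP [sK rK]].
  by rewrite big_nil; exact: continuous_subspace0.
rewrite big_cons; apply: withinU_continuous; [| |exact: gc|exact: IHr].
  exact/hull_closed/(faces_indep sK).
apply: closed_bigsetU => s' s'r; apply/hull_closed/(@faces_indep _ _ _ K).
exact: (allP rK).
Qed.

(** On each simplex the extension is the combination of the [x v] by the affine
barycentric coordinates. Two simplexes [s] and [t] meet inside the hull of
[s :&: t], where the coordinates with respect to both of them are the ones with
respect to [s :&: t], extended by zero. *)
Lemma vertex_map_extension m (x : V -> 'rV[R]_m) :
  exists g : 'rV[R]_N -> 'rV[R]_m, semilinear_map K g /\
    (forall s c, s \in faces K -> barycentric s c ->
      g (\sum_(v in s) c v *: pos K v) = \sum_(v in s) c v *: x v).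
Proof.
pose betaP (s : {set V}) (beta : V -> 'rV[R]_N -> R) :=
  (forall v, continuous (beta v)) /\
  (forall c : V -> R, \sum_(v in s) c v = 1 ->
    forall v, beta v (\sum_(v in s) c v *: pos K v) =
      if v \in s then c v else 0).
have /choice [beta bP] (s : {set V}) :
    exists beta, s \in faces K -> betaP s beta.
  have [sK|sK] := boolP (s \in faces K); last by exists (fun=> fun=> 0).
  by have [b bP] := barycentric_coordinates (faces_indep sK); exists b.
pose g y := if [pick s in faces K | `[< simplex K s y >]] is Some s
  then \sum_v beta s v y *: x v else 0.
have betaE s t y v : s \in faces K -> t \in faces K ->
    simplex K s y -> simplex K t y -> beta s v y = beta t v y.
  move=> sK tK sy ty.
  have [c [c0 c1] yE] := faces_meet sK tK (conj sy ty).
  pose c' v := if v \in s :&: t then c v else 0.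
  suff betaE' (r : {set V}) :
      s :&: t \subset r -> r \in faces K -> beta r v y = c' v.
    by rewrite !betaE' ?finset.subsetIl ?finset.subsetIr.
  move=> str rK; have [_ rE] := bP r rK.
  have restrict (W : lmodType R) (f : V -> W) :
      \sum_(v in r) c' v *: f v = \sum_(v in s :&: t) c v *: f v.
    rewrite [LHS]big_mkcond [RHS]big_mkcond; apply: eq_bigr => w _.
    rewrite /c'; case: ifPn => [wr|]; first by case: ifP; rewrite ?scale0r.
    by case: ifPn => // /(fintype.subsetP str) ->.
  rewrite -yE -restrict rE.
    rewrite /c'; case: ifPn => // vr; case: ifPn => //.
    by move=> /(fintype.subsetP str) /idPn.
  rewrite -c1; transitivity (\sum_(w in r) c' w *: (1 : R^o)).
    by apply: eq_bigr => w _; rewrite [RHS]mulr1.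
  by rewrite restrict; apply: eq_bigr => w _; rewrite [LHS]mulr1.
have gE s y : s \in faces K -> simplex K s y ->
    g y = \sum_v beta s v y *: x v.
  move=> sK sy; rewrite /g; case: pickP => [t /andP [tK /asboolP ty]|].
    by apply: eq_bigr => v _; rewrite (betaE t s).
  by move=> /(_ s); rewrite sK asboolT.
have gx s c : s \in faces K -> barycentric s c ->
    g (\sum_(v in s) c v *: pos K v) = \sum_(v in s) c v *: x v.
  move=> sK sc; rewrite (gE s) //; last by exists c.
  rewrite [RHS]big_mkcond; apply: eq_bigr => v _.
  by rewrite (bP s sK).2 ?sc.2 //; case: ifP => _ //; rewrite scale0r.
exists g; split=> //; split.
  apply: within_polyhedron_continuous => s sK.
  apply: (@subspace_eq_continuous _ _ _ (fun y => \sum_v beta s v y *: x v)).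
    by move=> y /set_mem sy; symmetry; exact: gE.
  apply: continuous_subspaceT; apply: continuous_sum_fun => v y.
  by apply: continuousZr_tmp; exact: (bP s sK).1.
move=> s sK c sc; rewrite gx //; apply: eq_bigr => v vs.
have := gx [set v]%SET (fun=> 1) (face_vertex sK vs).
rewrite !big_set1 !scale1r => -> //.
by split=> [//|]; rewrite big_set1.
Qed.

End BarycentricExtension.

(** * Numerical form of the bounds *)

Section CountingBounds.
Variable R : realFieldType.

Lemma count_bound_general (q m n d t T : nat) :
  (t <= d)%N -> (d + n + 1 <= m)%N -> (d <= T)%N ->
  (q * m <= m - d + (T - d) * (d - t) + q * n + q * d)%N ->
  q%:R <= d%:R + 1 - t%:R
    + (n%:R + (n%:R + T%:R - m%:R) * (d%:R - t%:R)) / (m%:R - n%:R - d%:R) :> R.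
Proof.
move=> td dnm dT.
rewrite -(ler_nat R) !natrD !natrM !natrB //; last by lia.
have : (d + n + 1)%:R <= m%:R :> R by rewrite ler_nat.
rewrite !natrD => dnmR bound.
have pos0 : 0 < m%:R - n%:R - d%:R :> R by lra.
rewrite -lerBlDl ler_pdivlMr //; nra.
Qed.

Lemma count_bound_coordinate (q m n T : nat) :
  (T + n < m)%N -> (q * m <= m - T + q * n + q * T)%N ->
  q%:R <= 1 + n%:R / (m%:R - n%:R - T%:R) :> R.
Proof.
move=> Tnm; rewrite -(ler_nat R) !natrD !natrM !natrB //; last by lia.
move: Tnm; rewrite -(ltr_nat R) natrD => TnmR bound.
have pos0 : 0 < m%:R - n%:R - T%:R :> R by lra.
rewrite -lerBlDl ler_pdivlMr //; nra.
Qed.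

(** Otherwise [m - n - T < 0] and the hypothesis forces [n = 0], so that
[m < T]. *)
Lemma ambient_codim_gt0 (m n d t T : nat) : (t <= d)%N -> (T <= m)%N ->
  n%:R <= (m%:R - n%:R - T%:R) * (d%:R - t%:R) :> R ->
  m%:R - n%:R - T%:R != 0 :> R -> (T + n < m)%N.
Proof.
move=> td Tm h ne0; rewrite ltnNge; apply/negP => mTn.
have {ne0} lt0 : m%:R - n%:R - T%:R < 0 :> R.
  by rewrite lt_neqAle ne0 /= -addrA -opprD subr_le0 -natrD ler_nat addnC.
have dt0 : 0 <= d%:R - t%:R :> R by rewrite subr_ge0 ler_nat.
have n0 : n%:R = 0 :> R.
  by apply/eqP; rewrite eq_le ler0n andbT (le_trans h) // nmulr_rle0.
move: lt0; rewrite n0 subr0 subr_lt0 ltr_nat; lia.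
Qed.

End CountingBounds.

(** * Planes, distances and families of simplexes *)
(** Applied both ways, it shows that a plane has only one direction space. *)
Lemma has_direction_sub (R : realType) m (Pi : set 'rV[R]_m)
    (D D' : {vspace 'rV[R]_m}) :
  has_direction Pi D -> has_direction Pi D' -> (D <= D')%VS.
Proof.
move=> [p PiD] [p' PiD']; apply/subvP => v vD.
have : Pi p by rewrite PiD; exists 0; rewrite ?addr0 //= mem0v.
have : Pi (p + v) by rewrite PiD; exists v.
rewrite PiD' => -[w wD' wE] [w' w'D' w'E].
have -> : v = w - w'.
  by rewrite -(addKr p v) -wE -w'E opprD addrAC addrA addNr add0r addrC.
exact: memvB.
Qed.

(** The denominator [m.+1] is nonzero also for [m = 0], and it makes the inequality
[m * (eps / m.+1) ^+ 2 < eps ^+ 2] strict. *)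
Lemma euclidean_dist_lt (R : realType) m (x y : 'rV[R]_m) (eps : R) :
  0 < eps -> (forall i, `|x 0 i - y 0 i| < eps / m.+1%:R) ->
  euclidean_dist x y < eps.
Proof.
move=> eps0 xy; set eta := eps / _ in xy.
have eta0 : 0 < eta by rewrite divr_gt0.
rewrite -[ltRHS]gtr0_norm // -sqrtr_sqr ltr_sqrt ?exprn_gt0 //.
apply: (@le_lt_trans _ _ (\sum_(i < m) eta ^+ 2)).
  apply: ler_sum => i _; rewrite -real_normK ?num_real //.
  by rewrite ler_sqr ?nnegrE ?normr_ge0 ?ltW.
rewrite sumr_const card_ord -[eta ^+ 2 *+ m]mulr_natl.
have -> : eps = m.+1%:R * eta by rewrite mulrC divfK // pnatr_eq0.
rewrite [ltRHS]exprMn ltr_pM2r ?exprn_gt0 // -natrX ltr_nat; nia.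
Qed.

Lemma simplexes_vertex_disjoint (R : realType) N (V : finType)
    (K : simplicial_complex R N V) (F : {set {set V}}) :
  classical_sets.trivIset [set` F] (simplex K) -> vertex_disjoint F.
Proof.
move=> Ftriv s s' v sF s'F vs vs'; apply: Ftriv => //.
have in_simplex (r : {set V}) : v \in r -> simplex K r (pos K v).
  move=> vr; have off w : w \in r :\ v -> ((w == v)%:R : R) = 0.
    by rewrite !inE => /andP [/negbTE->].
  exists (fun w => (w == v)%:R); first split=> [w _|]; rewrite ?ler0n //.
    by rewrite (big_setD1 v) //= eqxx big1 ?addr0.
  rewrite (big_setD1 v) //= eqxx scale1r big1 ?addr0 // => w /off ->.
  exact: scale0r.
by exists (pos K v); split; exact: in_simplex.
Qed.

(** * Generic semi-linear maps *)

Unset Implicit Arguments.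

Theorem corollary1p2 (R : realType) (N m : nat) (V : finType)
    (K : simplicial_complex R N V) (theta : 'rV[R]_N -> 'rV[R]_m) (eps : R)
    (theta_semilinear : semilinear_map K theta) (eps_gt0 : 0 < eps) :
  exists g : 'rV[R]_N -> 'rV[R]_m,
    [/\ semilinear_map K g,
        forall v, is_vertex K v ->
          euclidean_dist (g (pos K v)) (theta (pos K v)) < eps &
        forall n d t T : nat,
          (t <= d)%N -> (d + n + 1 <= m)%N -> (d <= T)%N -> (T <= m)%N ->
        forall (Pi : set 'rV[R]_m) (Pt PT : {vspace 'rV[R]_m}),
          affine_plane d Pi -> coordinate_plane t Pt ->
          coordinate_plane T PT -> (Pt <= PT)%VS -> parallel Pi Pt PT ->
        forall F : {set {set V}},
          (forall s, s \in F ->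
            [/\ s \in faces K, (simplex_dim s <= n)%N &
                (g @` simplex K s) `&` Pi !=set0]) ->
          classical_sets.trivIset [set` F] (simplex K) ->
        (((m%:R - n%:R - T%:R) * (d%:R - t%:R) <= n%:R :> R) ->
          #|F|%:R <= d%:R + 1 - t%:R
            + (n%:R + (n%:R + T%:R - m%:R) * (d%:R - t%:R))
              / (m%:R - n%:R - d%:R) :> R) /\
        ((n%:R <= (m%:R - n%:R - T%:R) * (d%:R - t%:R) :> R) ->
          m%:R - n%:R - T%:R != 0 :> R ->
          #|F|%:R <= 1 + n%:R / (m%:R - n%:R - T%:R) :> R)].
Proof.
pose x0 (vi : V * 'I_m) := theta (pos K vi.1) 0 vi.2.
have [x xgen xx0] := generic_near x0 (divr_gt0 eps_gt0 (ltr0Sn R m)).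
have [g [g_lin gE]] := vertex_map_extension K (fun v => \row_i x (v, i)).
exists g; split=> // [v vK|].
  have := gE [set v]%SET (fun=> 1) vK.
  rewrite !big_set1 !scale1r => ->; last first.
    by split=> [//|]; rewrite big_set1.
  by apply: euclidean_dist_lt => // i; rewrite mxE; exact: xx0 (v, i).
move=> n d t T td dnm dT Tm Pi Pt PT [D1 dimD1 PiD1] [St St_card PtE]
  [ST ST_card PTE] PtPT [D PiD /andP [PtD DPT]] F FP Ftriv.
have dimD : \dim D = d.
  rewrite -dimD1; congr (\dim _); apply/eqP; rewrite eqEsubv.
  by rewrite (has_direction_sub PiD PiD1) (has_direction_sub PiD1 PiD).
have Fd := simplexes_vertex_disjoint Ftriv.
have [p0 PiE] := PiD.
have Fn s : s \in F -> (#|s| <= n.+1)%N.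
  by move=> /FP [_ sn _]; rewrite (leq_trans (leqSpred _)).
have Fpoint s : s \in F -> exists2 c : V -> R, \sum_(v in s) c v = 1 &
    \sum_(v in s) c v *: \row_i x (v, i) - p0 \in D.
  move=> /FP [sK _ [y [[z [c sc <-] <-]]]].
  rewrite PiE => -[w /= wD wE]; exists c; first exact: sc.2.
  by rewrite -gE // -wE addrC addKr.
rewrite PtE in PtD; rewrite PTE in DPT.
split=> [_|nle ne0].
  apply: count_bound_general => //.
  have := generic_plane_bound xgen PtD DPT Fd Fn Fpoint.
  by rewrite dimD St_card ST_card.
(* The plane lies in the translate of coordspan ST through p0. *)
apply: count_bound_coordinate; first exact: (ambient_codim_gt0 td Tm nle ne0).
have := generic_plane_bound (base := p0) xgen
  (subvv (coordspan R ST)) (subvv _) Fd Fn.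
rewrite dim_coordspan ST_card subnn mul0n addn0; apply=> s /Fpoint [c c1 cD].
by exists c => //; exact: (subvP DPT _ cD).
Qed.
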